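(* Let $d,m\ge1$ be integers. For bounded measurable $f:\mathcal X\to\mathbb R$, let $X_1,\dots,X_n\sim\mathcal U(\mathcal X)$ be independent, let the random index $I\in\{1,\dots,n\}$ satisfy $P(I=i\mid X_1,\dots,X_n)=\exp(f(X_i))/\sum_{j=1}^n\exp(f(X_j))$, and let $\tilde P_f$ be the distribution of $X_I$. Then for all $B>0$ and $n\ge1$ with $Bn^{-1/d}\ge4d\log(4d)$, \[\sup_{f\in\mathcal F_{d,m,B}}D_{\mathrm{TV}}(P_f,\tilde P_f)\ge\tfrac12.\]
   Context: $\mathcal X=[0,1]^d$ with Lebesgue measure; $\mathcal U(\mathcal X)$ the uniform distribution. $P_f$ has density $e^f/\int_{\mathcal X}e^f dx$. $\|f\|_{C^m}=\sup_{\alpha\in\mathbb N_0^d,|\alpha|_1\le m}\|\partial^\alpha f\|_\infty$ and $\mathcal F_{d,m,B}=\{f\in C^m(\mathcal X):\|f\|_{C^m}\le B\}$. $D_{\mathrm{TV}}(P,Q)=\sup_{A}|P(A)-Q(A)|$. *)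

(* Defs.v *)
From HB Require Import structures.
From mathcomp Require Import all_boot all_order all_algebra.
From mathcomp Require Import all_classical all_reals all_analysis.
Set Implicit Arguments. Unset Strict Implicit. Unset Printing Implicit Defensive.
Import Order.TTheory GRing.Theory Num.Theory.
Import numFieldNormedType.Exports.
Local Open Scope classical_set_scope.
Local Open Scope ring_scope.

Section Defs.
Variable R : realType.

(* Points of R^d as row vectors (for differentiation). *)
Definition cube (d : nat) : set 'rV[R]_d := [set x | forall j, 0 <= x 0 j <= 1].

Definition pderiv (d : nat) (j : 'I_d) (g : 'rV[R]_d -> R) : 'rV[R]_d -> R :=
  fun x => 'D_(delta_mx 0 j) g x.

Definition iter_pderiv (d : nat) (s : seq 'I_d) (g : 'rV[R]_d -> R) :=
  foldr (@pderiv d) g s.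

Definition pderivA (d : nat) (alpha : 'I_d -> nat) (g : 'rV[R]_d -> R) :=
  foldr (fun j h => iter (alpha j) (@pderiv d j) h) g (enum 'I_d).

Definition Cm (d m : nat) (g : 'rV[R]_d -> R) : Prop :=
  forall s : seq 'I_d,
    ((size s <= m)%N -> continuous (iter_pderiv s g)) /\
    ((size s < m)%N -> forall j x, derivable (iter_pderiv s g) x (delta_mx 0 j)).

Definition Fclass (d m : nat) (B : R) : set ('rV[R]_d -> R) :=
  [set g | @Cm d m g /\
     forall alpha : 'I_d -> nat, (\sum_(j < d) alpha j <= m)%N ->
       forall x, cube x -> `|pderivA alpha g x| <= B].

(* points of R^d as d-tuples (product Borel sigma-algebra) *)
Definition rowOf (d : nat) (x : d.-tuple R) : 'rV[R]_d := \row_j tnth x j.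

(* U is the uniform distribution on X = [0,1]^d (Lebesgue measure on the cube),
   characterised by its values on boxes contained in the cube. *)
Definition uniform_cube (d : nat) (U : probability (d.-tuple R) R) : Prop :=
  forall a b : d.-tuple R, (forall j, (0 <= tnth a j <= tnth b j) && (tnth b j <= 1)) ->
    U [set x | forall j, tnth a j <= tnth x j <= tnth b j] =
    (\prod_(j < d) (tnth b j - tnth a j))%:E.

Definition Pf (d : nat) (U : probability (d.-tuple R) R) (f : 'rV[R]_d -> R)
  : set (d.-tuple R) -> \bar R :=
  fun A => (Rintegral U A (fun x => expR (f (rowOf x))) /
            Rintegral U setT (fun x => expR (f (rowOf x))))%:E.

Definition iid_law (d n : nat) (U : probability (d.-tuple R) R)
  (dO : measure_display) (O : measurableType dO) (P : probability O R)
  (X : 'I_n -> O -> d.-tuple R) : Prop :=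
  forall A : 'I_n -> set (d.-tuple R), (forall i, measurable (A i)) ->
    P (\bigcap_(i in [set: 'I_n]) (X i @^-1` A i)) = (\prod_(i < n) U (A i))%E.

Definition Xvec (d n : nat) (O : Type) (X : 'I_n -> O -> d.-tuple R) (w : O)
  : n.-tuple (d.-tuple R) := [tuple X i w | i < n].

Definition sir_weight (d n : nat) (f : 'rV[R]_d -> R) (O : Type)
  (X : 'I_n -> O -> d.-tuple R) (i : 'I_n) (w : O) : R :=
  expR (f (rowOf (X i w))) / \sum_(j < n) expR (f (rowOf (X j w))).

(* P(I = i | X_1, ..., X_n) = sir_weight i, i.e. for every event G in
   sigma(X_1,...,X_n), P({I = i} ∩ G) = \int_G sir_weight i dP *)
Definition sir_index (d n : nat) (f : 'rV[R]_d -> R)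
  (dO : measure_display) (O : measurableType dO) (P : probability O R)
  (X : 'I_n -> O -> d.-tuple R) (I : O -> 'I_n) : Prop :=
  forall (i : 'I_n) (C : set (n.-tuple (d.-tuple R))), measurable C ->
    P ([set w | I w = i] `&` (Xvec X @^-1` C)) =
    (\int[P]_(w in Xvec X @^-1` C) (sir_weight f X i w)%:E)%E.

Definition law_XI (d n : nat) (dO : measure_display) (O : measurableType dO)
  (P : probability O R) (X : 'I_n -> O -> d.-tuple R) (I : O -> 'I_n)
  : set (d.-tuple R) -> \bar R :=
  fun A => P [set w | A (X (I w) w)].

Definition dTV (dT : measure_display) (T : measurableType dT)
  (mu nu : set T -> \bar R) : \bar R :=
  ereal_sup [set `|(mu A - nu A)%E|%E | A in [set A : set T | measurable A]].

End Defs.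

(* Main.v *)
Require Import Defs.
From HB Require Import structures.
From mathcomp Require Import all_boot all_order all_algebra.
From mathcomp Require Import all_classical all_reals all_analysis.
From mathcomp Require Import measurable_realfun lra.
Import Order.TTheory GRing.Theory Num.Theory.
Import numFieldNormedType.Exports.
Local Open Scope classical_set_scope.
Local Open Scope ring_scope.

(* The witness is the linear function f(x) = lam * (x_1 + ... + x_d) with
   lam = B / d.  Both laws are compared on the corner [1 - t, 1]^d, where
   n t^d = 1/4.  The resampled point lies in the corner only if some X_i does,
   which has probability at most n t^d = 1/4.  On the other hand, translation
   by t along the j-th axis preserves the uniform law and multiplies e^f by
   e^(lam t), so under P_f the event x_j < 1 - t has probability at most
   e^(- lam t), which the hypothesis on B makes at most 1 / (4 d); hence the
   corner has P_f-mass at least 3/4. *)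

(** * Boxes as a generating pi-system of the product Borel sigma-algebra *)

Section Boxes.
Context {R : realType} {d : nat}.
Implicit Types a b : 'I_d -> R.

Definition box a b : set (d.-tuple R) :=
  [set x | forall j, a j <= tnth x j <= b j].

Lemma boxI a b a' b' : box a b `&` box a' b' =
  box (fun j => Num.max (a j) (a' j)) (fun j => Num.min (b j) (b' j)).
Proof.
apply/seteqP; split => x /=.
  move=> [h h'] j; rewrite ge_max le_min.
  by move: (h j) (h' j) => /andP[-> ->] /andP[-> ->].
move=> h; split => j; move: (h j); rewrite ge_max le_min;
  by move=> /andP[/andP[? ?] /andP[? ?]]; apply/andP.
Qed.

Lemma measurable_box a b : measurable (box a b).
Proof.
have -> : box a b =
    \bigcap_(j in [set: 'I_d]) ((fun x : d.-tuple R => tnth x j) @^-1` `[a j, b j]).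
  apply/seteqP; split => x /=.
    by move=> h j _ /=; rewrite in_itv /=; exact: h.
  by move=> h j; move: (h j I); rewrite /= in_itv.
apply: fin_bigcap_measurable; first exact: finite_finset.
move=> j _; rewrite -[X in measurable X]setTI.
by apply: measurable_tnth => //; exact: measurable_itv.
Qed.

Lemma tuple_nat_bound (x : d.-tuple R) :
  exists k : nat, forall j, - k%:R <= tnth x j <= k%:R.
Proof.
exists (\max_(j < d) Num.bound `|tnth x j|) => j.
rewrite -ler_norml; apply: (@le_trans _ _ (Num.bound `|tnth x j|)%:R).
  by apply/ltW/archi_boundP/normr_ge0.
by rewrite ler_nat; exact: (leq_bigmax j).
Qed.

(** Only the inclusion of the product sigma-algebra needs work: it is generated by cylinders over
    one coordinate, and Borel sets of the line by rays, so it suffices to treat cylinders over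
    rays. *)
Lemma sigma_box : @measurable _ (d.-tuple R) = <<s [set box a b | a in setT & b in setT] >>.
Proof.
apply/seteqP; split; last first.
  apply: smallest_sub; first exact: sigma_algebra_measurable.
  by move=> _ [a _ [b _ <-]]; exact: measurable_box.
apply: smallest_sub; first exact: smallest_sigma_algebra.
move=> A; rewrite -bigcup_seq => -[j _ [Y mY <-]]; rewrite setTI.
set G := [set box a b | a in setT & b in setT].
(* Good-sets argument: [H] is a sigma-algebra on the line, so it is enough that it contains every
   ray $[c,+\infty[$. *)
pose H : set (set R) := [set Z | <<s G >> ((fun x : d.-tuple R => tnth x j) @^-1` Z)].
suff : (@ocitv R).-sigma.-measurable `<=` H by exact.
rewrite RGenCInfty.measurableE.
apply: smallest_sub.
  split; rewrite /H /=.
  - by rewrite preimage_set0; exact: sigma_algebra0.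
  - by move=> Z hZ; rewrite setTD preimage_setC; exact: sigma_algebraC.
  - by move=> F hF; rewrite preimage_bigcup; exact: sigma_algebra_bigcup.
move=> _ [c ->]; rewrite /H /=.
(* The cylinder over a ray is exhausted by boxes whose free bounds are $\pm k$, since every point
   has bounded coordinates. *)
have -> : (fun x : d.-tuple R => tnth x j) @^-1` `[c, +oo[ =
    \bigcup_k box (fun i => if i == j then c else - k%:R) (fun=> k%:R).
  apply/seteqP; split => x /=.
    rewrite in_itv /= andbT => cx; have [k hk] := tuple_nat_bound x.
    exists k => // i; case: eqP => [->|_]; last exact: hk.
    by rewrite cx /=; have /andP[] := hk j.
  by move=> [k _ /(_ j)]; rewrite eqxx in_itv /= andbT => /andP[].
apply: sigma_algebra_bigcup => k; apply: sub_sigma_algebra.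
by eexists => //; eexists.
Qed.

(** Boxes are stable under intersection, generate the sigma-algebra, and the boxes $[-k,k]^d$ of
    finite measure exhaust the space, so uniqueness of measures applies. *)
Lemma measure_eq_box (m1 m2 : {measure set (d.-tuple R) -> \bar R}) :
  (forall a b, m1 (box a b) = m2 (box a b)) ->
  (forall a b, (m1 (box a b) < +oo)%E) ->
  forall A, measurable A -> m1 A = m2 A.
Proof.
move=> m12 fin A; pose g k := box (fun=> - k%:R) (fun=> k%:R).
apply: (measure_unique [set box a b | a in setT & b in setT] g).
- exact: sigma_box.
- move=> _ _ [a _ [b _ <-]] [a' _ [b' _ <-]]; rewrite boxI.
  by eexists => //; eexists.
- by move=> k; eexists => //; eexists.
- by apply/seteqP; split => x // _; have [k hk] := tuple_nat_bound x; exists k.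
- by move=> _ [a _ [b _ <-]].
- by move=> k; exact: fin.
Qed.

End Boxes.

(** * The uniform law on all boxes and its invariance under translation *)

Section UniformCube.
Context {R : realType} {d : nat} (U : probability (d.-tuple R) R).
Hypothesis uniU : uniform_cube U.
Implicit Types a b : 'I_d -> R.

Local Notation unit_box := (@box R d (fun=> 0) (fun=> 1)).

Lemma uniform_cube_unit_box : U unit_box = 1%E.
Proof.
have := @uniU [tuple 0 | _ < d] [tuple 1 | _ < d].
under [X in U X = _]eq_set => x do under eq_forall => j do rewrite !tnth_mktuple.
rewrite [X in _ = X%:E]big1 => [-> // j|j _]; rewrite !tnth_mktuple ?subr0 //.
by rewrite lexx ler01 lexx.
Qed.

Lemma uniform_cube_unit_boxC : U (~` unit_box) = 0%E.
Proof.
by rewrite probability_setC ?uniform_cube_unit_box ?subee //; exact: measurable_box.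
Qed.

(** [uniform_cube] speaks only of boxes inside the cube. Since the complement of the cube is null,
    any box may first be cut down to it; each factor is the length of $[a_j,b_j]\cap[0,1]$, and is 0
    if that is empty. *)
Lemma uniform_cube_box a b :
  U (box a b) = (\prod_(j < d) Num.max 0 (Num.min (b j) 1 - Num.max (a j) 0))%:E.
Proof.
have -> : U (box a b) = U (box a b `&` unit_box).
  apply/eqP; rewrite eq_le; apply/andP; split; last first.
    by apply: le_measure; rewrite ?inE; [apply: measurableI| |exact: subIsetl];
      exact: measurable_box.
  rewrite -[leRHS]adde0 -uniform_cube_unit_boxC.
  apply: le_trans (measureU2 _ _ _); last 2 first.
  - by apply: measurableI; exact: measurable_box.
  - by apply: measurableC; exact: measurable_box.
  apply: le_measure; rewrite ?inE.
  - exact: measurable_box.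
  - by apply: measurableU; [apply: measurableI|apply: measurableC]; exact: measurable_box.
  - by move=> x bx; have [ux|nux] := pselect (unit_box x); [left|right].
rewrite boxI; set a' := fun j => _; set b' := fun j => _.
(* If some side is reversed, the box is empty and the factor of that side vanishes. *)
have [/forallP le_ab|/forallPn[j]] := boolP [forall j, a' j <= b' j].
  transitivity (U [set x | forall j, tnth [tuple a' i | i < d] j <= tnth x j
                                    <= tnth [tuple b' i | i < d] j]).
    congr (U _); apply/seteqP; split => x /= h j; have := h j; by rewrite !tnth_mktuple.
  rewrite uniU => [|j].
    congr (_%:E); apply: eq_bigr => j _; rewrite !tnth_mktuple.
    by rewrite (max_idPr _) // subr_ge0; exact: le_ab.
  by rewrite !tnth_mktuple le_ab /a' /b' le_max lexx orbT /= ge_min lexx orbT.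
rewrite -ltNge => lt_ba.
have -> : box a' b' = set0.
  apply/seteqP; split => x //= /(_ j) /andP[h1 h2].
  by have := le_trans h1 h2; rewrite leNgt lt_ba.
rewrite measure0 (bigD1 j) //= [X in X * _](max_idPl _) ?mul0r //.
by rewrite subr_le0; exact: ltW.
Qed.

Definition shift_coord (j : 'I_d) (t : R) (x : d.-tuple R) : d.-tuple R :=
  [tuple tnth x i + (if i == j then t else 0) | i < d].

Lemma measurable_shift_coord j t : measurable_fun setT (shift_coord j t).
Proof.
apply/measurable_fun_tnthP => i /=.
rewrite (_ : _ \o _ = (fun x => tnth x i + (if i == j then t else 0))); last first.
  by apply/funext => x /=; rewrite tnth_mktuple.
apply: measurable_funD; [exact: measurable_tnth|exact: measurable_cst].
Qed.

(** Translation by [t] along axis [j] carries [lower_slab j t] onto [upper_slab j t], both within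
    the cube when $t\ge0$. *)
Definition upper_slab (j : 'I_d) (t : R) : set (d.-tuple R) :=
  box (fun i => if i == j then t else 0) (fun=> 1).

Definition lower_slab (j : 'I_d) (t : R) : set (d.-tuple R) :=
  box (fun=> 0) (fun i => if i == j then 1 - t else 1).

Lemma preimage_shift_box j t a b : shift_coord j t @^-1` box a b =
  box (fun i => a i - (if i == j then t else 0))
      (fun i => b i - (if i == j then t else 0)).
Proof.
by apply/seteqP; split => x /= h i; have := h i;
  rewrite tnth_mktuple lerBlDr lerBrDr.
Qed.

Lemma preimage_shift_upper_slab j t :
  shift_coord j t @^-1` upper_slab j t = lower_slab j t.
Proof.
rewrite preimage_shift_box; congr box; apply/funext => i; case: eqP => _;
  by rewrite ?subrr ?subr0.
Qed.

(** Restricted to the upper slab, [U] and its image under the translation agree on boxes, hence on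
    all measurable sets. The restriction keeps mass from being pushed across the boundary of the
    cube. *)
Lemma uniform_cube_shift j t A : 0 <= t -> measurable A ->
  A `<=` upper_slab j t -> U (shift_coord j t @^-1` A) = U A.
Proof.
move=> t0 mA AE.
have mS := measurable_shift_coord j t.
have mE : measurable (upper_slab j t) by exact: measurable_box.
pose pushU : {measure set (d.-tuple R) -> \bar R} := pushforward U (shift_coord j t).
pose V := pushU mS.
have <- : mrestr V mE A = U (shift_coord j t @^-1` A).
  by rewrite /mrestr (setIidl AE).
have <- : mrestr U mE A = U A by rewrite /mrestr (setIidl AE).
apply: measure_eq_box => [||//] a b; rewrite /= /mrestr /= /pushforward /upper_slab boxI
  preimage_shift_box.
  rewrite !uniform_cube_box; congr (_%:E); apply: eq_bigr => i _.
  case: eqP => _; rewrite ?subr0 //.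
  (* In coordinate [j] both intervals lie in $[0,1]$ because $t\ge0$, so clipping to the cube leaves
     their common length unchanged. *)
  by rewrite /Num.max /Num.min; repeat case: ifPn; lra.
by apply: le_lt_trans (probability_le1 _ _) (ltry _); exact: measurable_box.
Qed.

Lemma integral_shift j t (g : d.-tuple R -> \bar R) :
  0 <= t -> measurable_fun setT g -> (forall x, 0 <= g x)%E ->
  (\int[U]_(x in lower_slab j t) g (shift_coord j t x) =
   \int[U]_(x in upper_slab j t) g x)%E.
Proof.
move=> t0 mg g0.
have mS := measurable_shift_coord j t.
have mE : measurable (upper_slab j t) by exact: measurable_box.
rewrite -preimage_shift_upper_slab -(ge0_integral_pushforward mS) //; last first.
  by apply: measurable_funTS.
apply: (eq_measure_integral U) => A mA AE; exact: uniform_cube_shift.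
Qed.

End UniformCube.

(** * The linear witness and its membership in the smoothness class *)

Section Ramp.
Context {R : realType} {d : nat}.

Definition ramp (B : R) (x : 'rV[R]_d) : R := B / d%:R * \sum_(j < d) x 0 j.

Lemma continuous_ramp B : continuous (ramp B).
Proof.
move=> x.
have cvg_sum : (fun y : 'rV[R]_d => \sum_(j < d) y 0 j) @ x --> \sum_(j < d) x 0 j.
  apply: (@cvg_big _ _ _ _ xpredT add_continuous _ (nbhs x) _ _ _ (nbhs_filter x)) => j _.
  exact: coord_continuous.
exact: cvgM (cvg_cst (B / d%:R)) cvg_sum.
Qed.

Lemma rampDZ B h (v x : 'rV[R]_d) : ramp B (h *: v + x) = h * ramp B v + ramp B x.
Proof.
rewrite /ramp; under eq_bigr => j _ do rewrite !mxE.
by rewrite big_split /= -mulr_sumr mulrDr mulrCA.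
Qed.

(** By linearity the difference quotient equals [ramp B v] for every nonzero increment. *)
Lemma is_derive_ramp B (x v : 'rV[R]_d) : is_derive x v (ramp B) (ramp B v).
Proof.
have h0 : h^-1 *: ((ramp B \o shift x) (h *: v) - ramp B x) @[h --> 0^'] --> ramp B v.
  apply: cvg_near_cst; near=> h.
  rewrite /= rampDZ addrK; apply: mulKf.
  by near: h; exact: nbhs_dnbhs_neq.
apply: DeriveDef; first by apply/cvg_ex; exists (ramp B v).
exact: cvg_lim.
Unshelve. all: by end_near. Qed.

Lemma ramp_delta B (j : 'I_d) : ramp B (delta_mx 0 j) = B / d%:R.
Proof.
rewrite /ramp (bigD1 j) //= big1 ?addr0 => [|i ij]; rewrite mxE !eqxx ?(negPf ij) //=.
by rewrite mulr1.
Qed.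

Lemma pderiv_ramp B (j : 'I_d) : pderiv j (ramp B) = cst (B / d%:R).
Proof.
apply/funext => x.
by rewrite /pderiv (@derive_val _ _ _ _ _ _ _ (is_derive_ramp _ _ _)) ramp_delta.
Qed.

Lemma pderiv_cst (c : R) (j : 'I_d) : pderiv j (cst c) = cst 0.
Proof. by apply/funext => x; rewrite /pderiv derive_cst. Qed.

(** An invariant closed under partial derivatives, which therefore covers derivatives of every
    order; the range of the constants carries the bound by [B]. *)
Definition ramp_or_const B (g : 'rV[R]_d -> R) : Prop :=
  g = ramp B \/ exists2 c, 0 <= c <= B & g = cst c.

Lemma pderiv_ramp_or_const B g (j : 'I_d) : 0 <= B ->
  ramp_or_const B g -> ramp_or_const B (pderiv j g).
Proof.
move=> B0 [->|[c _ ->]]; right; last by exists 0; rewrite ?lexx ?pderiv_cst.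
exists (B / d%:R); last exact: pderiv_ramp.
(* The existence of the index [j] excludes $d=0$, whence $B/d\le B$. *)
have d0 : (0 < d)%N by apply: leq_ltn_trans (ltn_ord j).
by rewrite divr_ge0 //= ler_piMr // invf_le1 ?ltr0n // ler1n.
Qed.

Lemma ramp_cube B (x : 'rV[R]_d) : 0 <= B -> cube x -> 0 <= ramp B x <= B.
Proof.
move=> B0 cx.
have s0 : 0 <= \sum_(j < d) x 0 j by apply: sumr_ge0 => j _; have /andP[] := cx j.
have s1 : \sum_(j < d) x 0 j <= d%:R.
  rewrite -[d in leRHS]card_ord -sum1_card natr_sum; apply: ler_sum => j _.
  by have /andP[] := cx j.
rewrite /ramp mulr_ge0 ?divr_ge0 //=.
(* For $d=0$ the convention $0^{-1}=0$ makes the function zero. *)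
have [d0|d0] := posnP d; first by rewrite [in X in X^-1]d0 invr0 mulr0 mul0r.
by rewrite mulrAC ler_pdivrMr ?ltr0n // ler_wpM2l.
Qed.

Lemma ramp_Fclass B m : 0 <= B -> Fclass m B (ramp B).
Proof.
move=> B0; split.
  move=> s; have : ramp_or_const B (iter_pderiv s (ramp B)).
    by elim: s => [|j s ih] /=; [left|exact: pderiv_ramp_or_const].
  move=> [->|[c _ ->]]; split=> _.
  - exact: continuous_ramp.
  - by move=> j x; have [] := is_derive_ramp B x (delta_mx 0 j).
  - exact: cst_continuous.
  - by move=> j x; exact: derivable_cst.
move=> alpha _ x cx.
have : ramp_or_const B (pderivA alpha (ramp B)).
  rewrite /pderivA; elim: (enum 'I_d) => [|j s ih] /=; first by left.
  by elim: (alpha j) => [//|k ihk] /=; exact: pderiv_ramp_or_const.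
move=> [->|[c /andP[c0 cB] ->]]; last by rewrite /= ger0_norm.
by have /andP[f0 fB] := ramp_cube _ _ B0 cx; rewrite ger0_norm.
Qed.

End Ramp.

(** Union bound for integrals: the pieces may overlap, and on [D] the sum of the restrictions of [g]
    dominates [g] pointwise. *)
Lemma ge0_integral_cover (dT : measure_display) (T : measurableType dT) (R : realType)
    (mu : {measure set T -> \bar R}) (I : finType) (D : set T) (F : I -> set T)
    (g : T -> \bar R) :
  measurable D -> (forall i, measurable (F i)) -> measurable_fun setT g ->
  (forall x, 0 <= g x)%E -> D `<=` \bigcup_(i in [set: I]) F i ->
  (\int[mu]_(x in D) g x <= \sum_i \int[mu]_(x in F i) g x)%E.
Proof.
move=> mD mF mg g0 DF.
have r0 A x : (0 <= (g \_ A) x)%E by rewrite patchE; case: ifP.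
have mr A : measurable A -> measurable_fun setT (g \_ A).
  by move=> mA; apply/(measurable_restrictT g mA); exact: measurable_funTS.
under eq_bigr => i _ do rewrite integral_mkcond.
rewrite integral_mkcond -ge0_integral_sum //; last by move=> i; exact: mr.
apply: ge0_le_integral => //; first exact: mr.
  by apply: emeasurable_sum => i; exact: mr.
move=> x _; rewrite [leLHS]patchE; case: ifPn => [|_]; last exact: sume_ge0.
rewrite inE => /DF [i _ Fix].
rewrite (bigD1 i) //= [X in (_ <= X + _)%E]patchE mem_set //.
by rewrite leeDl // sume_ge0.
Qed.

(** * Mass of the corner under the tilted law *)

Section RampTilt.
Context {R : realType} {d : nat} (U : probability (d.-tuple R) R) (B t : R).
Hypotheses (uniU : uniform_cube U) (B_gt0 : 0 < B) (t_ge0 : 0 <= t).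

Local Notation unit_box := (@box R d (fun=> 0) (fun=> 1)).

(** The unnormalised density of $P_f$ for the witness. *)
Definition tilt (x : d.-tuple R) : R := expR (ramp B (rowOf x)).

Definition top_corner : set (d.-tuple R) := box (fun=> 1 - t) (fun=> 1).

Lemma tiltE x : tilt x = expR (B / d%:R * \sum_(j < d) tnth x j).
Proof. by rewrite /tilt /ramp; under eq_bigr => j _ do rewrite mxE. Qed.

Lemma measurable_tilt : measurable_fun setT tilt.
Proof.
rewrite (_ : tilt = expR \o (fun x => B / d%:R * \sum_(j < d) tnth x j)); last first.
  by apply/funext => x; rewrite tiltE.
apply: measurableT_comp; first exact: measurable_expR.
apply: measurable_funM; first exact: measurable_cst.
by apply: measurable_sum => j; exact: measurable_tnth.
Qed.

Lemma emeasurable_tilt : measurable_fun setT (EFin \o tilt).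
Proof. by apply/measurable_EFinP; exact: measurable_tilt. Qed.

Lemma etilt_ge0 x : (0 <= (tilt x)%:E)%E.
Proof. by rewrite lee_fin expR_ge0. Qed.

Lemma tilt_unit_box x : unit_box x -> 1 <= tilt x <= expR B.
Proof.
move=> ux.
have cx : cube (rowOf x) by move=> j; rewrite mxE; exact: ux.
have /andP[r0 rB] := ramp_cube B _ (ltW B_gt0) cx.
by rewrite /tilt ler_expR rB -[leLHS]expR0 ler_expR r0.
Qed.

Lemma tilt_shift j x : tilt (shift_coord j t x) = expR (B / d%:R * t) * tilt x.
Proof.
rewrite !tiltE -expRD -mulrDr; congr (expR (_ * _)).
under eq_bigr => i _ do rewrite tnth_mktuple.
by rewrite big_split /= addrC -big_mkcond /= big_pred1_eq.
Qed.

Local Notation Z := (\int[U]_x (tilt x)%:E)%E.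

Lemma tilt_mass_unit_box : Z = (\int[U]_(x in unit_box) (tilt x)%:E)%E.
Proof.
rewrite (@ge0_negligible_integral _ _ _ U setT (~` unit_box)) ?setTD ?setCK //.
- by apply: measurableC; exact: measurable_box.
- exact: emeasurable_tilt.
- by move=> x _; exact: etilt_ge0.
- exact: uniform_cube_unit_boxC.
Qed.

(** The witness is nonnegative on the cube, so the density is at least 1 there. This makes the
    normalising constant positive. *)
Lemma tilt_mass_ge1 : (1 <= Z)%E.
Proof.
rewrite tilt_mass_unit_box -(uniform_cube_unit_box U uniU) -[leLHS]mul1e.
rewrite -integral_cst; last exact: measurable_box.
apply: ge0_le_integral => //; first exact: measurable_box.
- exact: measurable_funTS emeasurable_tilt.
- by move=> x /tilt_unit_box /andP[? _]; rewrite lee_fin.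
Qed.

Lemma tilt_mass_fin_num : Z \is a fin_num.
Proof.
rewrite ge0_fin_numE; last by apply: le_trans tilt_mass_ge1; rewrite lee_fin.
apply: (@le_lt_trans _ _ (expR B)%:E); last exact: ltry.
rewrite tilt_mass_unit_box -[leRHS]mule1 -(uniform_cube_unit_box U uniU).
rewrite -integral_cst; last exact: measurable_box.
apply: ge0_le_integral => //.
- exact: measurable_box.
- by move=> x _; exact: etilt_ge0.
- exact: measurable_funTS emeasurable_tilt.
- by move=> x /tilt_unit_box /andP[_ ?]; rewrite lee_fin.
Qed.

(** Translating the lower slab to the upper one multiplies the density by $e^{Bt/d}$, and the upper
    slab carries at most the total mass. *)
Lemma tilt_lower_slab (j : 'I_d) :
  (\int[U]_(x in lower_slab j t) (tilt x)%:E <= (expR (- (B / d%:R * t)))%:E * Z)%E.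
Proof.
have le_upper : (\int[U]_(x in upper_slab j t) (tilt x)%:E <= Z)%E.
  apply: ge0_subset_integral => //; first exact: measurable_box.
  - exact: emeasurable_tilt.
  - by move=> x _; exact: etilt_ge0.
rewrite -(integral_shift U uniU j t (EFin \o tilt)) // in le_upper; last 2 first.
- exact: emeasurable_tilt.
- exact: etilt_ge0.
have := @lee_wpmul2l _ (expR (- (B / d%:R * t)))%:E (expR_ge0 _) _ _ le_upper.
apply: le_trans; rewrite -ge0_integralZl //.
- rewrite le_eqVlt; apply/orP; left; apply/eqP; apply: eq_integral => x _.
  by rewrite /= tilt_shift -EFinM mulrA -expRD addNr expR0 mul1r.
- exact: measurable_box.
- apply: measurable_funTS; apply: (measurableT_comp emeasurable_tilt).
  exact: measurable_shift_coord.
- by move=> x _; exact: etilt_ge0.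
Qed.

Lemma unit_box_cover :
  unit_box `\` top_corner `<=` \bigcup_(j in [set: 'I_d]) lower_slab j t.
Proof.
move=> x [ux /existsNP[j nj]]; exists j => // i.
have /andP[-> xi1] /= := ux i; case: eqP => // ->.
by move/negP: nj; have /andP[_ ->] := ux j; rewrite andbT -ltNge => /ltW.
Qed.

(** A point of the cube outside the corner lies in one of the [d] lower slabs; a union bound over
    them, divided by the total mass, bounds the missing probability. *)
Lemma Pf_top_corner :
  ((1 - d%:R * expR (- (B / d%:R * t)))%:E <= Pf U (ramp B) top_corner)%E.
Proof.
rewrite /Pf /Rintegral -/(tilt _) lee_fin.
have mA : measurable top_corner by exact: measurable_box.
have mA' : measurable (unit_box `\` top_corner).
  by apply: measurableD => //; exact: measurable_box.
(* [Rintegral] is the real part of an extended integral, so finiteness is required before passing to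
   real inequalities. *)
have A_fin : (\int[U]_(x in top_corner) (tilt x)%:E)%E \is a fin_num.
  rewrite ge0_fin_numE; last by apply: integral_ge0 => x _; exact: etilt_ge0.
  apply: le_lt_trans (_ : Z < +oo)%E; last by rewrite ltey_eq tilt_mass_fin_num.
  apply: ge0_subset_integral => //; first exact: emeasurable_tilt.
  by move=> x _; exact: etilt_ge0.
have coverZ : (Z <= \int[U]_(x in top_corner) (tilt x)%:E +
    (d%:R * expR (- (B / d%:R * t)))%:E * Z)%E.
  rewrite {1}tilt_mass_unit_box.
  (* Indexing corner and remainder by a boolean lets the same covering bound split the total
     mass. *)
  pose F (b : bool) := if b then top_corner else unit_box `\` top_corner.
  apply: (@le_trans _ _ (\sum_(b : bool) \int[U]_(x in F b) (tilt x)%:E)%E).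
    apply: ge0_integral_cover; rewrite /F; [exact: measurable_box|by case|
      exact: emeasurable_tilt|exact: etilt_ge0|].
    move=> x ux; have [Ax|nAx] := pselect (top_corner x); first by exists true.
    by exists false.
  rewrite big_bool /=; apply: leeD => //.
  apply: (@le_trans _ _ (\sum_(j < d) \int[U]_(x in lower_slab j t) (tilt x)%:E)%E).
    apply: ge0_integral_cover => //; [by move=> j; exact: measurable_box|
      exact: emeasurable_tilt|exact: etilt_ge0|exact: unit_box_cover].
  apply: (@le_trans _ _ (\sum_(j < d) (expR (- (B / d%:R * t)))%:E * Z)%E).
    by apply: lee_sum => j _; exact: tilt_lower_slab.
  rewrite -(fineK tilt_mass_fin_num) -EFinM sumEFin -EFinM lee_fin.
  by rewrite sumr_const card_ord mulr_natl mulrnAl.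
have Z1 := tilt_mass_ge1.
rewrite -(fineK A_fin) -(fineK tilt_mass_fin_num) -EFinM -EFinD lee_fin in coverZ.
rewrite -(fineK tilt_mass_fin_num) lee_fin in Z1.
rewrite ler_pdivlMr; last exact: lt_le_trans Z1.
rewrite mulrBl mul1r lerBlDr; exact: coverZ.
Qed.

End RampTilt.

(** * Probability that the resampled point hits a given set *)

Lemma iid_law_marginal (R : realType) (d n : nat) (U : probability (d.-tuple R) R)
    (dO : measure_display) (O : measurableType dO) (P : probability O R)
    (X : 'I_n -> O -> d.-tuple R) (i : 'I_n) (A : set (d.-tuple R)) :
  iid_law U P X -> measurable A -> P (X i @^-1` A) = U A.
Proof.
move=> iidX mA.
have := iidX (fun k => if k == i then A else setT) _.
rewrite (bigD1 i) //= eqxx big1 => [|k /negPf ->]; last exact: probability_setT.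
rewrite mule1 => <- => [|k]; last by case: ifP.
congr (P _); apply/seteqP; split => w /=.
  by move=> AXw k _; case: eqP => [->|].
by move=> /(_ i I); rewrite eqxx.
Qed.

(** If $X_I\in A$ then $X_i\in A$ for $i=I$; the union bound over the [n] samples, each with law
    [U], gives the factor [n]. *)
Lemma law_XI_le (R : realType) (d n : nat) (U : probability (d.-tuple R) R)
    (dO : measure_display) (O : measurableType dO) (P : probability O R)
    (X : 'I_n -> O -> d.-tuple R) (I : O -> 'I_n) (A : set (d.-tuple R)) :
  (forall i, measurable_fun setT (X i)) ->
  (forall i, measurable [set w | I w = i]) ->
  iid_law U P X -> measurable A ->
  (law_XI P X I A <= n%:R%:E * U A)%E.
Proof.
move=> mX mI iidX mA.
have mXA i : measurable (X i @^-1` A) by rewrite -[X in measurable X]setTI; exact: mX.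
have mE : measurable [set w | A (X (I w) w)].
  have -> : [set w | A (X (I w) w)] =
      \bigcup_(i in [set: 'I_n]) ([set w | I w = i] `&` X i @^-1` A).
    apply/seteqP; split => w /=; first by move=> AX; exists (I w).
    by move=> [i _ [/= -> ?]].
  by apply: fin_bigcup_measurable => [|i _]; [exact: finite_finset|exact: measurableI].
(* The probability is written as the integral of 1 so that the covering bound becomes the usual
   union bound. *)
rewrite /law_XI -[leLHS]mul1e -integral_cst //.
apply: (@le_trans _ _ (\sum_(i < n) \int[P]_(w in X i @^-1` A) cst 1 w)%E).
  by apply: ge0_integral_cover => // w /= AX; exists (I w).
have UA_fin : U A \is a fin_num by exact: fin_num_measure.
have intE i : (\int[P]_(w in X i @^-1` A) cst 1 w = (fine (U A))%:E)%E.
  by rewrite fineK // integral_cst // mul1e; exact: (iid_law_marginal _ _ _ U).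
under eq_bigr => i _ do rewrite intE.
by rewrite -(fineK UA_fin) sumEFin -EFinM lee_fin sumr_const card_ord mulr_natl.
Qed.

Lemma dTV_ge (R : realType) (dT : measure_display) (T : measurableType dT)
    (mu nu : set T -> \bar R) (A : set T) :
  measurable A -> (mu A - nu A <= dTV mu nu)%E.
Proof.
move=> mA; apply: le_trans (lee_abs _) _.
by apply: ereal_sup_ubound; exists A.
Qed.

(* [(4 n)^(-1/d)] is the side for which the expected number of sample points in
   the corner is [1/4]. *)
Definition corner_side (R : realType) (d n : nat) : R := (4 * n%:R) `^ (- d%:R^-1).

(** * Numerical estimates for the side of the corner *)

Section CornerSide.
Context {R : realType} {d n : nat}.
Hypotheses (d_gt0 : (0 < d)%N) (n_gt0 : (0 < n)%N).

Local Notation t := (corner_side R d n).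

Lemma corner_side_ge0 : 0 <= t.
Proof. exact: powR_ge0. Qed.

Lemma corner_side_exp : t ^+ d = (4 * n%:R)^-1.
Proof.
have n0 : (0 : R) <= 4 * n%:R by rewrite mulr_ge0.
rewrite -powR_mulrn ?powR_ge0 // -powRrM mulNr mulVf ?powR_inv1 //.
by rewrite pnatr_eq0 -lt0n.
Qed.

(** This keeps the corner inside the cube, so that its uniform mass is exactly $t^d$. *)
Lemma corner_side_le1 : t <= 1.
Proof.
have n1 : (1 : R) <= n%:R by rewrite ler1n.
rewrite -(@expr_le1 _ d) ?corner_side_ge0 //.
by rewrite corner_side_exp invf_le1; lra.
Qed.

(** Since $t=4^{-1/d}n^{-1/d}\ge n^{-1/d}/4$, the hypothesis gives $Bt/d\ge\log(4d)$. *)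
Lemma corner_side_rate (B : R) : 0 < B ->
  4 * d%:R * ln (4 * d%:R) <= B * n%:R `^ (- d%:R^-1) ->
  d%:R * expR (- (B / d%:R * t)) <= 4^-1.
Proof.
move=> B0 hB.
have dR0 : (0 : R) < d%:R by rewrite ltr0n.
(* The crude bound $4^{-1/d}\ge1/4$, valid for $d\ge1$, accounts for the factor 4 in front of
   $d\log(4d)$. *)
have quarter : (4 : R)^-1 <= 4 `^ (- d%:R^-1).
  rewrite -powR_inv1 //; apply: ler_powR; first by lra.
  by rewrite lerN2 invf_le1 // ler1n.
have q0 : (0 : R) <= n%:R `^ (- d%:R^-1) by exact: powR_ge0.
have rate : ln (4 * d%:R) <= B / d%:R * t.
  rewrite /corner_side powRM //.
  apply: (@le_trans _ _ (B / d%:R * (4^-1 * n%:R `^ (- d%:R^-1)))); last first.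
    by rewrite ler_wpM2l ?divr_ge0 ?(ltW B0) // ler_wpM2r.
  rewrite mulrAC ler_pdivlMr //; lra.
have : 4 * d%:R <= expR (B / d%:R * t).
  by rewrite -[leLHS]lnK ?posrE ?ler_expR ?mulr_gt0.
by rewrite expRN ler_pdivrMr ?expR_gt0 //; lra.
Qed.

End CornerSide.

(** * The corner separates the two laws *)

Theorem theorem21 (R : realType) (d m : nat) (B : R) (n : nat) :
  (1 <= d)%N -> (1 <= m)%N -> 0 < B -> (1 <= n)%N ->
  4 * d%:R * ln (4 * d%:R) <= B * (n%:R `^ (- (d%:R)^-1)) ->
  forall eps : R, 0 < eps ->
  exists f : 'rV[R]_d -> R, Fclass m B f /\
    forall (U : probability (d.-tuple R) R), uniform_cube U ->
    forall (dO : measure_display) (O : measurableType dO) (P : probability O R)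
      (X : 'I_n -> O -> d.-tuple R) (I : O -> 'I_n),
      (forall i, measurable_fun setT (X i)) ->
      (forall i, measurable [set w | I w = i]) ->
      iid_law U P X ->
      sir_index f P X I ->
      ((1 / 2 - eps)%:E <= dTV (Pf U f) (law_XI P X I))%E.
Proof.
move=> d0 _ B0 n0 hB eps eps0; exists (ramp B); split.
  by apply: ramp_Fclass; exact: ltW.
move=> U uniU dO O P X I mX mI iidX _.
pose t := corner_side R d n.
have t0 : 0 <= t := corner_side_ge0.
have t1 : t <= 1 := corner_side_le1 d0 n0.
have mA : measurable (@top_corner R d t) by exact: measurable_box.
apply: le_trans (dTV_ge _ _ _ _ _ (top_corner t) mA).
have nR0 : (0 : R) < n%:R by rewrite ltr0n.
have law_le : (law_XI P X I (top_corner t) <= 4^-1%:E)%E.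
  apply: le_trans (law_XI_le _ _ _ U _ _ _ _ _ _ mX mI iidX mA) _.
  rewrite (uniform_cube_box _ uniU) -EFinM lee_fin.
  have t1' : 0 <= 1 - t by rewrite subr_ge0.
  (* As $0\le t\le1$, every clipped side has length [t], and $n t^d=1/4$. *)
  under eq_bigr => j _ do rewrite minxx (max_idPl t1') subKr (max_idPr t0).
  rewrite prodr_const card_ord (corner_side_exp d0).
  by rewrite invfM mulrCA divff ?mulr1 // gt_eqF.
have Pf_ge := Pf_top_corner U B t uniU B0 t0.
have rate := corner_side_rate d0 _ B0 hB.
(* The corner has mass at least $3/4$ under $P_f$ and at most $1/4$ under $\tilde P_f$; the gap is
   at least $1/2$ for this one witness. *)
apply: (@le_trans _ _ ((3 / 4)%:E - 4^-1%:E)%E).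
  by rewrite -EFinB lee_fin; lra.
apply: leeB => //; apply: le_trans Pf_ge; rewrite lee_fin -/t in rate *; lra.
Qed.
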